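(* Let $K$ be a field and let $M$ be a nonzero finitely generated commutative binoid that is positive and reduced. If $M$ is not separated, then there exists an irreducible component of $K\text{-}\mathrm{spec}\,M$ that does not contain the special point.
   Context: A commutative binoid (written additively) is a commutative monoid $(M,+,0)$ with an absorbing element $\infty$ ($a+\infty=\infty$); nonzero means $0\ne\infty$. Homomorphisms are monoid homomorphisms with $\infty\mapsto\infty$. $M^\times$ is the group of units and $M_+=M\setminus M^\times$. $M$ is finitely generated if finitely many elements exist such that every element $\neq\infty$ is a finite sum of them; positive if $M^\times=\{0\}$; reduced if $na=\infty$ for some $n\ge1$ implies $a=\infty$. For $n\ge1$, $nM_+=\{a_1+\cdots+a_n\mid a_i\in M_+\}$. A nonzero binoid $M$ is separated if $\bigcap_{n\ge1}nM_+=\{\infty\}$. For a field $K$, viewed as the binoid $(K,\cdot,1,0)$, $K\text{-}\mathrm{spec}\,M$ is the set of binoid homomorphisms $\varphi:M\to K$. Let $K[M]$ be the $K$-algebra with basis $T^a$, $a\in M\setminus\{\infty\}$, and $T^aT^b=T^{a+b}$ if $a+b\ne\infty$, $0$ otherwise; $\varphi$ extends to $\tilde\varphi:K[M]\to K$, $\sum r_aT^a\mapsto\sum r_a\varphi(a)$. The closed sets of $K\text{-}\mathrm{spec}\,M$ are $\{\varphi\mid\tilde\varphi(F)=0\ \forall F\in S\}$, $S\subseteq K[M]$. Irreducible components are maximal irreducible subsets. The special point is the $K$-point with $a\mapsto1$ for $a\in M^\times$ and $a\mapsto0$ otherwise. *)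

(* Defs.v *)
From HB Require Import structures.
From mathcomp Require Import all_boot all_order all_algebra.
From mathcomp Require Import finmap.
From mathcomp Require Import boolp classical_sets topology.
From mathcomp.multinomials Require Import monalg.

Set Implicit Arguments.
Unset Strict Implicit.
Unset Printing Implicit Defensive.

Import GRing.Theory.
Local Open Scope classical_set_scope.
Local Open Scope ring_scope.

(* [nmodType] is the library's additive commutative monoid [(M, +, 0)]. *)
HB.mixin Record Nmodule_isBinoid M of GRing.Nmodule M := {
  infty : M ;
  addr_infty : forall a : M, a + infty = infty
}.

#[short(type="binoidType")]
HB.structure Definition Binoid := { M of GRing.Nmodule M & Nmodule_isBinoid M }.

Arguments infty {M} : rename.

Section BinoidTheory.
Variable M : binoidType.

Definition nonzero_binoid : Prop := (0 : M) <> infty.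

Definition binoid_units : set M := [set a | exists b, a + b = 0].

Definition binoid_plus : set M := ~` binoid_units.

Definition finitely_generated_binoid : Prop :=
  exists s : seq M, forall a : M, a <> infty ->
    exists2 t : seq M, {subset t <= s} & a = \sum_(x <- t) x.

Definition positive_binoid : Prop := binoid_units = [set 0].

Definition reduced_binoid : Prop :=
  forall (a : M) (n : nat), (1 <= n)%N -> a *+ n = infty -> a = infty.

Definition nfold_plus (n : nat) : set M :=
  [set a | exists2 x : 'I_n -> M,
     forall i, binoid_plus (x i) & a = \sum_(i < n) x i].

Definition separated_binoid : Prop :=
  \bigcap_(n in [set n | (1 <= n)%N]) nfold_plus n = [set infty].

Lemma binoid_unitsD (a b : M) :
  binoid_units (a + b) <-> binoid_units a /\ binoid_units b.
Proof.
split=> [[c abc0]|[[c ac0] [d bd0]]].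
  by split; [exists (b + c) | exists (a + c); rewrite addrCA]; rewrite addrA.
by exists (c + d); rewrite addrACA ac0 bd0 addr0.
Qed.

Lemma binoid_units0 : binoid_units 0.
Proof. by exists 0; rewrite addr0. Qed.

Lemma binoid_units_infty : nonzero_binoid -> ~ binoid_units infty.
Proof. by move=> nz [b]; rewrite addrC addr_infty => /esym. Qed.

End BinoidTheory.

(* The algebra K[M]: finitely supported functions on M \ {infty}. *)
Definition binoid_algebra (K : fieldType) (M : binoidType) : Type :=
  {malg K[{a : M | a != infty}]}.

HB.instance Definition _ (K : fieldType) (M : binoidType) :=
  GRing.Lmodule.copy (binoid_algebra K M) {malg K[{a : M | a != infty}]}.

Section BinoidAlgebra.
Variables (K : fieldType) (M : binoidType).
Local Notation KM := (binoid_algebra K M).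

(* T^a, with the convention T^infty = 0. *)
Definition binoid_mon (a : M) : KM :=
  if insub a is Some b then << b >> else 0.

(* The linear map sending T^a to h a for a != infty. *)
Definition binoid_lift (V : lmodType K) (h : M -> V) (F : KM) : V :=
  \sum_(a <- msupp F) F@_a *: h (val a).

Definition binoid_one : KM := binoid_mon 0.

Definition binoid_mul (F G : KM) : KM :=
  binoid_lift (fun a => binoid_lift (fun b => binoid_mon (a + b)) G) F.

Lemma binoid_liftEw (V : lmodType K) (h : M -> V) (d : {fset {a : M | a != infty}})
    (F : KM) : (msupp F `<=` d)%fset ->
  binoid_lift h F = \sum_(a <- d) F@_a *: h (val a).
Proof.
move=> le; rewrite /binoid_lift (big_fset_incl _ le) // => a _ /mcoeff_outdom.
by move=> ->; rewrite scale0r.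
Qed.

Lemma binoid_lift_is_linear (V : lmodType K) (h : M -> V) :
  linear (binoid_lift h).
Proof.
move=> c F G.
pose d := (msupp F `|` msupp G `|` msupp (c *: F + G))%fset.
rewrite !(@binoid_liftEw _ _ d); first last.
- by rewrite /d fsubsetUr.
- by rewrite /d -fsetUA fsubsetUl.
- by rewrite /d fsetUAC fsubsetUr.
rewrite scaler_sumr -big_split; apply: eq_bigr => a _ /=.
by rewrite mcoeffD mcoeffZ scalerDl scalerA.
Qed.

HB.instance Definition _ (V : lmodType K) (h : M -> V) :=
  GRing.isLinear.Build K KM V *:%R (binoid_lift h) (binoid_lift_is_linear h).

Lemma binoid_mon_infty : binoid_mon infty = 0.
Proof. by rewrite /binoid_mon insubF // eqxx. Qed.

Lemma binoid_lift_mon (V : lmodType K) (h : M -> V) (a : M) :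
  h infty = 0 -> binoid_lift h (binoid_mon a) = h a.
Proof.
move=> h0; rewrite /binoid_mon; case: insubP => [b _ ba|]; last first.
  by rewrite negbK => /eqP ->; rewrite linear0 h0.
by rewrite (binoid_liftEw _ msuppU_le) big_seq_fset1 mcoeffUU scale1r ba.
Qed.

Lemma binoid_liftE (V : lmodType K) (f : {linear KM -> V}) (F : KM) :
  f F = binoid_lift (f \o binoid_mon) F.
Proof.
rewrite {1}(monalgE F) raddf_sum; apply: eq_bigr => a _ /=.
rewrite /binoid_mon valK -linearZ; congr (f _).
apply/malgP => k; rewrite mcoeffZ !mcoeffU mulr_natr.
by case: eqP => // ->.
Qed.

Lemma binoid_algebra_ext (V : lmodType K) (f g : {linear KM -> V}) :
  (forall a, f (binoid_mon a) = g (binoid_mon a)) -> f =1 g.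
Proof.
move=> fg F; rewrite (binoid_liftE f) (binoid_liftE g).
by apply: eq_bigr => a _; congr (_ *: _); exact: fg.
Qed.

Lemma binoid_mulDl : left_distributive binoid_mul +%R.
Proof. by move=> F G H; rewrite /binoid_mul linearD. Qed.

Lemma binoid_mulZl c F G : binoid_mul (c *: F) G = c *: binoid_mul F G.
Proof. by rewrite /binoid_mul linearZ. Qed.

Lemma binoid_mulC : commutative binoid_mul.
Proof.
move=> F G; rewrite /binoid_mul /binoid_lift.
under eq_bigr do rewrite scaler_sumr.
rewrite exchange_big /=; apply: eq_bigr => a _; rewrite scaler_sumr.
by apply: eq_bigr => b _; rewrite !scalerA mulrC addrC.
Qed.

Lemma binoid_mulZr c F G : binoid_mul F (c *: G) = c *: binoid_mul F G.
Proof. by rewrite ![binoid_mul F _]binoid_mulC binoid_mulZl. Qed.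

Lemma binoid_mulDr : right_distributive binoid_mul +%R.
Proof. by move=> F G H; rewrite ![binoid_mul F _]binoid_mulC binoid_mulDl. Qed.

Fact binoid_mul_is_linear F : linear (binoid_mul F).
Proof. by move=> c G H; rewrite binoid_mulDr binoid_mulZr. Qed.

HB.instance Definition _ F :=
  GRing.isLinear.Build K KM KM *:%R (binoid_mul F) (binoid_mul_is_linear F).

Lemma binoid_mulMM a b :
  binoid_mul (binoid_mon a) (binoid_mon b) = binoid_mon (a + b).
Proof.
rewrite /binoid_mul !binoid_lift_mon ?addr_infty ?binoid_mon_infty //.
by rewrite addrC addr_infty binoid_mon_infty.
Qed.

Lemma binoid_mul1 : left_id binoid_one binoid_mul.
Proof.
apply: (@binoid_algebra_ext _ (binoid_mul binoid_one) idfun) => a /=.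
by rewrite binoid_mulMM add0r.
Qed.

Lemma binoid_mulA : associative binoid_mul.
Proof.
move=> F G H; move: H.
apply: (@binoid_algebra_ext _ (binoid_mul F \o binoid_mul G)
          (binoid_mul (binoid_mul F G))) => c /=.
rewrite ![binoid_mul _ (binoid_mon c)]binoid_mulC; move: G.
apply: (@binoid_algebra_ext _ (binoid_mul F \o binoid_mul (binoid_mon c))
          (binoid_mul (binoid_mon c) \o binoid_mul F)) => b /=.
rewrite binoid_mulMM ![binoid_mul F _]binoid_mulC; move: F.
apply: (@binoid_algebra_ext _ (binoid_mul (binoid_mon (c + b)))
          (binoid_mul (binoid_mon c) \o binoid_mul (binoid_mon b))) => a /=.
by rewrite !binoid_mulMM addrA.
Qed.

(* Only a possibly trivial ring: K[M] = 0 when M is the zero binoid. *)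
HB.instance Definition _ := GRing.Zmodule_isComPzRing.Build KM
  binoid_mulA binoid_mulC binoid_mul1 binoid_mulDl.

End BinoidAlgebra.

(* Binoid homomorphisms from M to the multiplicative binoid (K, *, 1, 0). *)
Record Kspec (K : fieldType) (M : binoidType) : Type := Kpoint {
  Kpoint_fun :> M -> K ;
  Kpoint0 : Kpoint_fun 0 = 1 ;
  KpointD : {morph Kpoint_fun : a b / a + b >-> a * b} ;
  Kpoint_infty : Kpoint_fun infty = 0
}.

HB.instance Definition _ K M := gen_eqMixin (Kspec K M).
HB.instance Definition _ K M := gen_choiceMixin (Kspec K M).

Section Zariski.
Variables (K : fieldType) (M : binoidType).
Local Notation KM := (binoid_algebra K M).

Definition Kpoint_ext (phi : Kspec K M) (F : KM) : K :=
  \sum_(a <- msupp F) F@_a * phi (val a).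

Definition zero_locus (S : set KM) : set (Kspec K M) :=
  [set phi | forall F, S F -> Kpoint_ext phi F = 0].

Fact Kpoint_ext_is_linear phi : scalar (Kpoint_ext phi).
Proof. exact: (@binoid_lift_is_linear K M K^o phi). Qed.

HB.instance Definition _ phi :=
  GRing.isLinear.Build K KM K *%R (Kpoint_ext phi) (Kpoint_ext_is_linear phi).

Lemma Kpoint_ext_mon phi a : Kpoint_ext phi (binoid_mon K a) = phi a.
Proof. exact: (@binoid_lift_mon K M K^o phi a (Kpoint_infty phi)). Qed.

Lemma Kpoint_ext1 phi : Kpoint_ext phi 1 = 1.
Proof. by rewrite Kpoint_ext_mon Kpoint0. Qed.

Lemma Kpoint_extM phi : {morph Kpoint_ext phi : F G / F * G}.
Proof.
move=> F G; rewrite [F * G]/(binoid_mul F G) raddf_sum /= mulr_suml.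
apply: eq_bigr => a _; rewrite linearZ /= -mulrA; congr (_ * _).
rewrite [LHS]raddf_sum mulr_sumr; apply: eq_bigr => b _.
by rewrite /= linearZ /= Kpoint_ext_mon KpointD mulrCA.
Qed.

Definition zariski_open (A : set (Kspec K M)) : Prop :=
  exists S : set KM, ~` A = zero_locus S.

Fact zariski_openT : zariski_open setT.
Proof.
exists [set 1]; apply/seteqP; split=> phi /=; first by move=> /(_ I).
by move=> /(_ _ erefl); rewrite Kpoint_ext1 => /eqP; rewrite oner_eq0.
Qed.

Fact zariski_openI : setI_closed zariski_open.
Proof.
move=> A B [S AS] [S' BS'].
exists [set H | exists F G, [/\ S F, S' G & H = F * G]].
rewrite setCI AS BS'; apply/seteqP; split=> phi /=.
  move=> VSS' _ [F [G [SF SG ->]]]; rewrite Kpoint_extM.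
  by case: VSS' => [/(_ _ SF)|/(_ _ SG)] ->; rewrite ?mul0r ?mulr0.
move=> VSS'; apply: contrapT => /not_orP[/existsNP[F /not_implyP[SF F0]]].
move=> /existsNP[G /not_implyP[SG G0]].
have /eqP := VSS' (F * G) (ex_intro _ F (ex_intro _ G (And3 SF SG erefl))).
by rewrite Kpoint_extM mulf_eq0 => /orP[] /eqP.
Qed.

Fact zariski_open_bigU (J : Type) (f : J -> set (Kspec K M)) :
  (forall i, zariski_open (f i)) -> zariski_open (\bigcup_i f i).
Proof.
move=> /choice[S fS]; exists (\bigcup_i S i).
rewrite setC_bigcup; apply/seteqP; split=> phi /=.
  by move=> fphi F [i _ SF]; have := fphi i I; rewrite fS; apply.
by move=> Vphi i _; rewrite fS => F SF; apply: Vphi; exists i.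
Qed.

HB.instance Definition _ := isOpenTopological.Build (Kspec K M)
  zariski_openT zariski_openI zariski_open_bigU.

Lemma zariski_closedP (C : set (Kspec K M)) :
  closed C <-> exists S : set KM, C = zero_locus S.
Proof.
rewrite -openC; split=> -[S CS]; exists S; first by rewrite -CS setCK.
by rewrite setCK.
Qed.

Section SpecialPoint.
Hypothesis nzM : nonzero_binoid M.

Definition special_fun (a : M) : K := (`[< binoid_units a >])%:R.

Fact special_fun0 : special_fun 0 = 1.
Proof. by rewrite /special_fun asboolT //; exact: binoid_units0. Qed.

Fact special_funD : {morph special_fun : a b / a + b >-> a * b}.
Proof.
move=> a b; rewrite /special_fun -natrM mulnb -asbool_and.
by congr (nat_of_bool _)%:R; apply: asbool_equiv_eq; exact: binoid_unitsD.
Qed.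

Fact special_fun_infty : special_fun infty = 0.
Proof. by rewrite /special_fun asboolF //; exact: binoid_units_infty. Qed.

Definition special_point : Kspec K M :=
  Kpoint special_fun0 special_funD special_fun_infty.

End SpecialPoint.
End Zariski.

Arguments special_point K {M} nzM.

Definition irreducible_set (T : topologicalType) (A : set T) : Prop :=
  A !=set0 /\ forall F G : set T, closed F -> closed G ->
    A `<=` F `|` G -> A `<=` F \/ A `<=` G.

Definition irreducible_component (T : topologicalType) (A : set T) : Prop :=
  irreducible_set A /\
  forall B : set T, irreducible_set B -> A `<=` B -> B = A.

(* Main.v *)
Require Import Defs.
From HB Require Import structures.
From mathcomp Require Import all_boot all_order all_algebra.
From mathcomp Require Import boolp classical_sets topology.

(** If [M] is not separated, some [f <> infty] is a sum of arbitrarily many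
    nonzero generators; by Dickson's lemma two such expressions are comparable,
    so [f + b = f] with [b <> 0]. Hence [T^f (T^b - 1) = 0], and the spectrum is
    the union of the closed sets [V(T^f)] and [V(T^b - 1)]. Since [M] is reduced,
    the indicator function of the filter generated by [f] is a K-point outside
    [V(T^f)]; an irreducible component through it lies in [V(T^b - 1)], which
    misses the special point because [b] is not a unit. *)

Import GRing.Theory.
Local Open Scope classical_set_scope.

Lemma strictly_increasing_geq (g : nat -> nat) :
  {homo g : i j / i < j} -> forall n, n <= g n.
Proof.
by move=> gincr; elim=> // n IHn; apply: leq_ltn_trans IHn (gincr _ _ _).
Qed.

(** Each chosen index is one where [u] attains its minimum on a tail; minima over shrinking tails
    cannot decrease. *)
Lemma nondecreasing_subsequence (u : nat -> nat) :
  exists2 g : nat -> nat, {homo g : i j / i < j} &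
    {homo u \o g : i j / i <= j}.
Proof.
have tail_min n : exists m, n <= m /\ forall k, n <= k -> u m <= u k.
  have ex : exists v, `[< exists2 m, n <= m & u m = v >].
    by exists (u n); apply/asboolP; exists n.
  case: (ex_minnP ex) => v /asboolP[m nm <-] vmin.
  by exists m; split=> // k nk; apply: vmin; apply/asboolP; exists k.
have [h hP] := choice tail_min.
(* The next tail starts just past the previous index, so [g] is strictly increasing. *)
pose g := fix g n := if n is n'.+1 then h (g n').+1 else h 0.
have gS n : g n < g n.+1 by have [] := hP (g n).+1.
have gincr : {homo g : i j / i < j}.
  exact: homo_ltn ltn_trans gS.
exists g => //; apply: homo_leq => //; first exact: leq_trans.
case=> [|n] /=; first by have [_] := hP 0; apply.
have [_] := hP (g n).+1; apply.
by apply: leq_trans (gS n) (ltnW (gS n.+1)).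
Qed.

(** Monotonicity survives passing to a further subsequence, so the coordinates in [s] are treated
    one at a time. *)
Lemma dickson_subsequence (T : eqType) (s : seq T) (u : nat -> T -> nat) :
  exists2 g : nat -> nat, {homo g : i j / i < j} &
    forall x, x \in s -> {homo (fun i => u (g i) x) : i j / i <= j}.
Proof.
elim: s => [|y s [g gincr gP]]; first by exists id.
have [h hincr hP] := nondecreasing_subsequence (fun i => u (g i) y).
exists (g \o h) => [i j ij|x]; first by apply: gincr; apply: hincr.
rewrite inE => /orP[/eqP ->|xs] i j ij; first exact: hP.
by apply: gP => //; move: i j ij; apply: ltnW_homo.
Qed.

Section NotSeparated.
Variable M : binoidType.
Local Open Scope ring_scope.

Lemma sum_infty (I : finType) (x : I -> M) (i : I) :
  x i = infty -> \sum_j x j = infty.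
Proof. by move=> xi; rewrite (bigD1 i) //= xi addrC addr_infty. Qed.

(** Zeros could pad an expression to any length, so they are dropped before lengths are compared. *)
Lemma sum_nonzero_generators (s : seq M) (a : M) :
  (exists2 t : seq M, {subset t <= s} & a = \sum_(x <- t) x) ->
  exists t : seq M, [/\ {subset t <= s}, 0 \notin t & a = \sum_(x <- t) x].
Proof.
case=> t ts ->; exists [seq x <- t | x != 0]; split.
- by move=> x; rewrite mem_filter => /andP[_ /ts].
- by rewrite mem_filter eqxx.
- rewrite big_filter [LHS](bigID (fun x => x != 0)) /=.
  rewrite [X in _ + X]big1 ?addr0 // => x.
  by rewrite negbK => /eqP.
Qed.

(** The empty sum is a unit, so each of the [n] non-units has a nonempty expression; these are
    concatenated. *)
Lemma nfold_plus_generators (s : seq M) (f : M) (n : nat) :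
  (forall a : M, a <> infty ->
    exists2 t : seq M, {subset t <= s} & a = \sum_(x <- t) x) ->
  f <> infty -> nfold_plus n f ->
  exists t : seq M, [/\ {subset t <= s}, 0 \notin t,
    f = \sum_(x <- t) x & (n <= size t)%N].
Proof.
move=> gen foo [x xplus fx].
have xoo i : x i <> infty by move=> xi; apply: foo; rewrite fx (sum_infty _ _ i).
have [t tP] := choice (fun i => sum_nonzero_generators s (x i) (gen _ (xoo i))).
exists (flatten [seq t i | i <- enum 'I_n]); split.
- by move=> y /flattenP[_ /mapP[i _ ->]]; have [ts _ _] := tP i; exact: ts.
- apply/flattenP => -[_ /mapP[i _ ->]].
  by have [_ /negP] := tP i.
- rewrite big_flatten big_map big_enum /= fx.
  by apply: eq_bigr => i _; have [] := tP i.
- rewrite size_flatten /shape -map_comp sumnE big_map big_enum /=.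
  rewrite -[n in (n <= _)%N]card_ord -sum1_card; apply: leq_sum => i _.
  have [_ _ xi] := tP i; rewrite lt0n size_eq0; apply/eqP => ti.
  by apply: (xplus i); rewrite xi ti big_nil; exact: binoid_units0.
Qed.

(** The remaining terms add up to an inverse of [x]. *)
Lemma sum_eq0_mem (t : seq M) (x : M) : positive_binoid M ->
  \sum_(y <- t) y = 0 -> x \in t -> x = 0.
Proof.
move=> posM t0 xt; suff : binoid_units x by rewrite posM.
by move: t0; rewrite (big_rem x xt) /= => t0; exists (\sum_(y <- rem x t) y).
Qed.

Lemma not_separated_periodic :
  nonzero_binoid M -> finitely_generated_binoid M -> positive_binoid M ->
  ~ separated_binoid M ->
  exists f b : M, [/\ f <> infty, ~ binoid_units b & f + b = f].
Proof.
move=> nzM [s gen] posM nsep.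
(* Since [infty] lies in every [nfold_plus n] with [n >= 1], separation can only fail through
   another element. *)
have [f foo fP] : exists2 f : M, f <> infty &
    forall n, (1 <= n)%N -> nfold_plus n f.
  apply: contrapT => nof; apply: nsep; apply/seteqP; split=> [f fP|_ ->] /=.
    by apply: contrapT => foo; apply: nof; exists f.
  move=> [//|n] _; exists (fun=> infty) => [_|]; first exact: binoid_units_infty.
  by rewrite (sum_infty _ _ ord0).
have [t tP] := choice (fun n =>
  nfold_plus_generators s f n.+1 gen foo (fP n.+1 isT)).
have [g gincr gP] := dickson_subsequence _ s (fun n x => count_mem x (t n)).
(* The expression at [g j] has more than [g j >= j] terms, so it is strictly longer than the one at
   [g 0]. *)
pose j := size (t (g 0%N)).
have [ts t0 ft _] := tP (g 0%N); have [us u0 fu ju] := tP (g j).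
have /count_subseqP[t' t'u tt'] (x : M) :
    (count_mem x (t (g 0%N)) <= count_mem x (t (g j)))%N.
  have [/ts xs|/count_memPn -> //] := boolP (x \in t (g 0%N)).
  exact: (gP x xs).
have [r ur] := perm_to_subseq t'u.
have fr : f = f + \sum_(x <- r) x.
  by rewrite {1}fu (perm_big _ ur) big_cat -(perm_big _ tt') -ft.
exists f, (\sum_(x <- r) x); split=> //; rewrite posM => r0.
(* An empty [r] contradicts the lengths; otherwise its first term would be [0], which was
   excluded. *)
case: r ur fr r0 => [ur _ _|x r ur _ r0].
  have := strictly_increasing_geq g gincr j.
  move: ju; rewrite (perm_size ur) cats0 -(perm_size tt') -/j => gj jg.
  by move: (leq_trans gj jg); rewrite ltnn.
have x0 := sum_eq0_mem _ x posM r0 (mem_head _ _).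
by move/negP: u0; apply; rewrite (perm_mem ur) mem_cat x0 mem_head orbT.
Qed.

End NotSeparated.

Section FilterPoint.
Variables (K : fieldType) (M : binoidType) (f : M).
Local Open Scope ring_scope.

(** The smallest submonoid containing [f] and closed under taking summands. *)
Definition binoid_filter : set M := [set a | exists b n, a + b = f *+ n].

Definition filter_fun (a : M) : K := (`[< binoid_filter a >])%:R.

Lemma filter_fun0 : filter_fun 0 = 1.
Proof. by rewrite /filter_fun asboolT //; exists 0, 0%N; rewrite addr0. Qed.

Lemma filter_funD : {morph filter_fun : a b / a + b >-> a * b}.
Proof.
move=> a b; rewrite /filter_fun -natrM mulnb -asbool_and.
congr (nat_of_bool _)%:R; apply: asbool_equiv_eq; split.
  move=> [c [n abc]]; split; [exists (b + c), n | exists (a + c), n].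
    by rewrite addrA.
  by rewrite addrCA addrA.
move=> [[c [n ac]] [d [m bd]]]; exists (c + d), (n + m)%N.
by rewrite addrACA ac bd mulrnDr.
Qed.

Hypotheses (nzM : nonzero_binoid M) (redM : reduced_binoid M).
Hypothesis f_infty : f <> infty.

(** If [infty] were in the filter, some [f *+ n] would be [infty]: impossible for [n = 0] as [M] is
    nonzero, and for [n >= 1] as [M] is reduced. *)
Lemma filter_fun_infty : filter_fun infty = 0.
Proof.
rewrite /filter_fun asboolF // => -[b [n]]; rewrite addrC addr_infty.
case: n => [/esym|n /esym fn]; first by rewrite mulr0n => /nzM.
exact/f_infty/(redM _ n.+1).
Qed.

Definition filter_point : Kspec K M :=
  Kpoint filter_fun0 filter_funD filter_fun_infty.

Lemma filter_point_gen : filter_point f = 1.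
Proof.
by rewrite /= /filter_fun asboolT //; exists 0, 1%N; rewrite addr0 mulr1n.
Qed.

End FilterPoint.

Lemma irreducible_component_through (T : topologicalType) (x : T) :
  exists2 C : set T, irreducible_component C & C x.
Proof.
(* Zorn also considers the empty chain, so the empty set is admitted at first. *)
pose P (A : set T) := (A !=set0 -> A x) /\ forall F G : set T,
  closed F -> closed G -> A `<=` F `|` G -> A `<=` F \/ A `<=` G.
have [|A [[Ax Airr] Amax]] := @Zorn_bigcup T P.
  move=> Q QP Qtot; split=> [[y [X QX Xy]]|F G cF cG UFG].
    by exists X => //; apply: (QP X QX).1; exists y.
  (* Points of the union outside [F] and outside [G] lie in a common member of the chain, which is
     irreducible. *)
  apply: contrapT => /not_orP[/existsNP[y /not_implyP[[Y QY Yy] Fy]]].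
  move=> /existsNP[z /not_implyP[[Z QZ Zz] Gz]].
  have subU X : Q X -> X `<=` F `|` G by move=> QX w Xw; apply: UFG; exists X.
  have [YZ|ZY] := Qtot Y Z QY QZ.
    have [ZF|ZG] := (QP Z QZ).2 F G cF cG (subU Z QZ).
      by apply/Fy/ZF/YZ.
    exact/Gz/ZG.
  have [YF|YG] := (QP Y QY).2 F G cF cG (subU Y QY).
    exact/Fy/YF.
  by apply/Gz/YG/ZY.
have {}Amax (B : set T) : P B -> A `<=` B -> B = A.
  move=> PB AB; apply/seteqP; split=> //; apply: contrapT => BA.
  by apply: (Amax B).
(* Were [A] empty, the singleton of [x] would be a larger admissible set. *)
have {}Ax : A x.
  apply: Ax; apply: contrapT => /set0P/negP; rewrite negbK => /eqP A0.
  suff /seteqP[/(_ x erefl)] : [set x] = A by rewrite A0.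
  apply: Amax; last by rewrite A0.
  split=> // F G _ _ xFG.
  by case: (xFG x erefl) => ?; [left|right] => _ ->.
exists A => //; split=> [|B [_ Birr] AB]; first by split=> //; exists x.
by apply: Amax => //; split=> // _; exact: AB.
Qed.

Lemma closed_zero_locus (K : fieldType) (M : binoidType)
    (S : set (binoid_algebra K M)) : closed (zero_locus S).
Proof. by apply/zariski_closedP; exists S. Qed.

Theorem corollary5p1p19 (K : fieldType) (M : binoidType)
    (nzM : nonzero_binoid M) (fgM : finitely_generated_binoid M)
    (posM : positive_binoid M) (redM : reduced_binoid M)
    (nsepM : ~ separated_binoid M) :
  exists C : set (Kspec K M),
    irreducible_component C /\ ~ C (special_point K nzM).
Proof.
have [f [b [foo bplus fb]]] := not_separated_periodic M nzM fgM posM nsepM.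
pose phi := filter_point K M f nzM redM foo.
have [C compC Cphi] := irreducible_component_through _ phi.
exists C; split=> // Cspec.
pose Vf := zero_locus [set binoid_mon K f].
pose Vb := zero_locus [set (binoid_mon K b - 1)%R].
have Cfb : C `<=` Vf `|` Vb.
  (* In the field [K], [psi f * (psi b - 1) = 0] forces one factor to vanish. *)
  move=> psi _; have := congr1 psi fb; rewrite KpointD => /eqP.
  rewrite -subr_eq0 -{2}[psi f]mulr1 -mulrBr mulf_eq0 => /orP[] /eqP psi0.
    by left=> _ ->; rewrite Kpoint_ext_mon.
  by right=> _ ->; rewrite raddfB /= Kpoint_ext_mon Kpoint_ext1.
have [[_ Cirr] _] := compC.
have [CVf|CVb] := Cirr _ _
  (closed_zero_locus _ _ _) (closed_zero_locus _ _ _) Cfb.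
  have := CVf _ Cphi _ erefl; rewrite Kpoint_ext_mon filter_point_gen.
  by move/eqP; rewrite oner_eq0.
(* The special point sends the non-unit [b] to [0], so [T^b - 1] takes the value [-1] there. *)
have := CVb _ Cspec _ erefl; rewrite raddfB /= Kpoint_ext_mon Kpoint_ext1 /=.
by rewrite /special_fun asboolF // sub0r => /eqP; rewrite oppr_eq0 oner_eq0.
Qed.
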